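(* Consider the rational generalized Nash equilibrium problem (rGNEP), the sets $X,\mathcal K,\mathcal S$ and the algorithm (Algorithm A) described in the context. Assume that for every $i\in[N]$ there is a tuple of rational functions $\tau_i=(\tau_{i,j})_{j\in \mathcal I^{(i)}_0\cup\mathcal I^{(i)}_1}$ in $x$, with denominators positive on $X$, such that $\lambda_{i,j}=\tau_{i,j}(x)$ for all $j\in \mathcal I^{(i)}_0\cup\mathcal I^{(i)}_1$ and for each critical pair $(x_i,\lambda_i)$ of $\mathrm F_i(x_{-i})$. Suppose that for every triple $(u,i,v_i)$ produced by Algorithm A (with $u\in\mathcal K$ the minimizer from Step 1, $i\in\mathcal N$, and $v_i$ the minimizer from Step 2) there exists a rational vector-valued function $p_i$ in $x$ such that $p_i(u)=v_i$ and $p_i(x)\in X_i(x_{-i})$ for all $x\in\mathcal K$. If the set $\mathcal K\setminus\mathcal S$ is finite, then Algorithm A must terminate within finitely many loops, and it either returns a GNE (in Step 2) or detects its nonexistence (it stops in Step 1 with an infeasible problem, in which case there is no GNE in $\mathcal K$, and hence no GNE at all if every GNE belongs to $\mathcal K$).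
   Context: **The problem.** There are $N$ players; $[N]=\{1,\dots,N\}$. Player $i$ has strategy $x_i\in\mathbb R^{n_i}$; $n=n_1+\cdots+n_N$, $x=(x_1,\dots,x_N)\in\mathbb R^n$, $x_{-i}=(x_1,\dots,x_{i-1},x_{i+1},\dots,x_N)$, and we also write $x=(x_i,x_{-i})$. Given $x_{-i}$, player $i$ solves $$\mathrm F_i(x_{-i}):\quad \min_{x_i\in\mathbb R^{n_i}} f_i(x_i,x_{-i})\quad\text{s.t. } x_i\in X_i(x_{-i}),$$ $$X_i(x_{-i})=\{x_i: g_{i,j}(x)=0\ (j\in\mathcal I^{(i)}_0),\ g_{i,j}(x)\ge0\ (j\in\mathcal I^{(i)}_1),\ g_{i,j}(x)>0\ (j\in\mathcal I^{(i)}_2)\},$$ with finite, possibly empty, disjoint label sets. All $f_i,g_{i,j}$ are real rational functions in $x$, with denominators positive on the feasible sets (i.e. at all $x$ with $x_i\in X_i(x_{-i})$). A point $u=(u_1,\dots,u_N)$ is a generalized Nash equilibrium (GNE) if each $u_i$ is a minimizer of $\mathrm F_i(u_{-i})$. $\mathcal S$ denotes the set of all GNEs. Let $X=\{x: x_i\in X_i(x_{-i}),\ i=1,\dots,N\}$. **Critical pairs.** $(x_i,\lambda_i)$, with $\lambda_i=(\lambda_{i,j})_{j\in\mathcal I^{(i)}_0\cup\mathcal I^{(i)}_1}$ a real vector, is a critical pair of $\mathrm F_i(x_{-i})$ if $x_i\in X_i(x_{-i})$, $\nabla_{x_i}f_i(x)=\sum_{j\in\mathcal I^{(i)}_0\cup\mathcal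 I^{(i)}_1}\lambda_{i,j}\nabla_{x_i}g_{i,j}(x)$, $\lambda_{i,j}g_{i,j}(x)=0$ for all $j\in \mathcal I^{(i)}_0\cup\mathcal I^{(i)}_1$, and $\lambda_{i,j}\ge0$ for $j\in\mathcal I^{(i)}_1$. (Multipliers of strict inequalities are zero.) **KKT set.** Given the $\tau_{i,j}$, let $$\mathcal K=\Big\{x\in X:\ \nabla_{x_i}f_i(x)=\sum_{j\in\mathcal I^{(i)}_0\cup\mathcal I^{(i)}_1}\tau_{i,j}(x)\nabla_{x_i}g_{i,j}(x)\ (i\in[N]),\ \tau_{i,j}(x)g_{i,j}(x)=0,\ \tau_{i,j}(x)\ge0\ (i\in[N],j\in\mathcal I^{(i)}_1)\Big\}.$$ **Algorithm A.** Write $[x]_1=(1,x^T)^T$. - Step 0. Let $\mathscr U:=\mathcal K$, $k:=0$, and fix a (generically chosen) positive definite $(n+1)\times(n+1)$ matrix $\Theta$. - Step 1. Solve $\min\,[x]_1^T\Theta[x]_1$ s.t. $x\in\mathscr U$. If it is infeasible, stop and output that either there are no GNEs or there is no GNE in $\mathcal K$. Otherwise let $u$ be a minimizer. - Step 2. For each $i\in[N]$ solve $\delta_i:=\min\{f_i(x_i,u_{-i})-f_i(u_i,u_{-i}) : x_i\in X_i(u_{-i})\}$ for a minimizer $v_i$. Let $\mathcal N:=\{i\in[N]:\delta_i<0\}$. If $\mathcal N=\emptyset$, return $u$ as a GNE and stop; otherwise go to Step 3. - Step 3. For each $i\in\mathcal N$ find a rational vector function $p_i$ in $x$ (feasible extension)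 with $p_i(u)=v_i$ and $p_i(x)\in X_i(x_{-i})$ for all $x\in\mathcal K$. Replace $\mathscr U$ by $\mathscr U\cap\{x\in\mathbb R^n: f_i(p_i(x),x_{-i})-f_i(x_i,x_{-i})\ge0\ \forall i\in\mathcal N\}$, set $k:=k+1$ and go to Step 1. **Convention.** Optimization problems are solved exactly, and the minimizers required in Steps 1 and 2 are assumed to exist whenever the corresponding problem is feasible. *)

(* Defs.v *)
From mathcomp Require Import all_boot all_order all_algebra.
From mathcomp Require Import boolp classical_sets cardinality reals.
From mathcomp Require Import topology normedtype derive.
From mathcomp Require Import -(notations) mpoly.
Import numFieldNormedType.Exports.
Set Implicit Arguments.
Unset Strict Implicit.
Unset Printing Implicit Defensive.
Import Order.TTheory GRing.Theory Num.Theory.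
Local Open Scope classical_set_scope.
Local Open Scope ring_scope.
(* The notations of multinomials clash with those of mathcomp-analysis:
   [mpoly n R] is {mpoly R[n]} and [meval v p] is p.@[v]. *)

(* A rational function in n variables, given by a numerator and a denominator
   that is not the zero polynomial.  It is a partial function: [rf_eval] is
   meaningful only on [rf_dom]. *)
Record ratfun (R : realType) (n : nat) := RatFun {
  rf_num : mpoly n R;
  rf_den : mpoly n R;
  rf_den_neq0 : rf_den != 0 }.

Section RatFun.
Context {R : realType} {n : nat}.
Implicit Types (r : ratfun R n) (x : 'rV[R]_n).

Definition num_at r x : R := meval (x ord0) (rf_num r).
Definition den_at r x : R := meval (x ord0) (rf_den r).
Definition rf_dom r : set 'rV[R]_n := [set x | den_at r x != 0].
Definition rf_eval r x : R := num_at r x / den_at r x.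
End RatFun.

Section Minimizer.
Context {R : realType} {T : Type}.

Definition is_minimizer (A : set T) (h : T -> R) (a : T) : Prop :=
  A a /\ forall b, A b -> h a <= h b.
End Minimizer.

Definition gradient {R : realType} {m : nat} (h : 'rV[R]_m -> R)
    (a : 'rV[R]_m) : 'rV[R]_m :=
  \row_k 'D_(delta_mx ord0 k) h a.

(* The labels of the equality, weak and strict inequality constraints of
   player i are I0 i, I1 i and I2 i. *)
Record rGNEP (R : realType) (N : nat) := RGNEP {
  strat_dim : 'I_N -> nat;
  I0 : 'I_N -> finType;
  I1 : 'I_N -> finType;
  I2 : 'I_N -> finType;
  obj : 'I_N -> ratfun R (\sum_i strat_dim i);
  con0 : forall i, I0 i -> ratfun R (\sum_i strat_dim i);
  con1 : forall i, I1 i -> ratfun R (\sum_i strat_dim i);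
  con2 : forall i, I2 i -> ratfun R (\sum_i strat_dim i) }.

Arguments con0 {R N} _ {i} _.
Arguments con1 {R N} _ {i} _.
Arguments con2 {R N} _ {i} _.

Section Problem.
Context {R : realType} {N : nat} (G : rGNEP R N).

Definition profile := 'rV[R]_(\sum_i strat_dim G i).
Definition strategy (i : 'I_N) := 'rV[R]_(strat_dim G i).
Implicit Types (x u : profile) (i : 'I_N).

Definition block x i : strategy i := submxrow x i.

(* (y, x_{-i}): the profile x with its i-th block replaced by y. *)
Definition replace x i (y : strategy i) : profile :=
  \mxrow_j eqtype.dfwith (block x) y j.

Definition objective x i (y : strategy i) : R :=
  rf_eval (obj G i) (replace x y).

(* X_i(x_{-i}) is [@feasible x i], which depends on x only through x_{-i}, and
   [feasible x y] says that y is in it, i being read off the type of y.  A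
   constraint holds at a point only if its rational function is defined there. *)
Definition feasible x i : set (strategy i) := [set y |
  [/\ forall j : I0 G i, rf_dom (con0 G j) (replace x y) /\
                         rf_eval (con0 G j) (replace x y) = 0,
      forall j : I1 G i, rf_dom (con1 G j) (replace x y) /\
                         0 <= rf_eval (con1 G j) (replace x y)
    & forall j : I2 G i, rf_dom (con2 G j) (replace x y) /\
                         0 < rf_eval (con2 G j) (replace x y)]].

Definition denominators_positive : Prop :=
  forall x i, feasible x (block x i) ->
    [/\ 0 < den_at (obj G i) x,
        forall j : I0 G i, 0 < den_at (con0 G j) x,
        forall j : I1 G i, 0 < den_at (con1 G j) x
      & forall j : I2 G i, 0 < den_at (con2 G j) x].

Definition joint_feasible : set profile :=
  [set x | forall i, feasible x (block x i)].

Definition GNE : set profile :=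
  [set u | forall i, is_minimizer (@feasible u i) (@objective u i) (block u i)].

(* The constraints carrying a multiplier, i.e. the non-strict ones. *)
Definition mult_label i := (I0 G i + I1 G i)%type.

Definition mcon i (j : mult_label i) : ratfun R (\sum_i strat_dim G i) :=
  match j with inl j0 => con0 G j0 | inr j1 => con1 G j1 end.

(* The gradient of r at x with respect to the block x_i. *)
Definition block_gradient (r : ratfun R (\sum_i strat_dim G i)) x i :
    strategy i :=
  gradient (fun y : strategy i => rf_eval r (replace x y)) (block x i).

Definition critical_pair x i (lambda : mult_label i -> R) : Prop :=
  [/\ feasible x (block x i),
      block_gradient (obj G i) x i =
        \sum_j lambda j *: block_gradient (mcon j) x i,
      forall j, lambda j * rf_eval (mcon j) x = 0
    & forall j : I1 G i, 0 <= lambda (inr j)].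

Section Algorithm.
Variable tau : forall i, mult_label i -> ratfun R (\sum_i strat_dim G i).

Definition multiplier_expressions : Prop :=
  [/\ forall i (j : mult_label i) x, joint_feasible x ->
        0 < den_at (tau j) x
    & forall x i (lambda : mult_label i -> R), critical_pair x lambda ->
        forall j, rf_dom (tau j) x /\ lambda j = rf_eval (tau j) x].

Definition KKT : set profile := [set x |
  [/\ joint_feasible x,
      forall i, block_gradient (obj G i) x i =
        \sum_(j : mult_label i)
           rf_eval (tau j) x *: block_gradient (mcon j) x i,
      forall i (j : mult_label i),
        rf_eval (tau j) x * rf_eval (mcon j) x = 0
    & forall i (j : I1 G i),
        0 <= rf_eval (tau (inr j : mult_label i)) x]].

Definition ratvec i := 'I_(strat_dim G i) -> ratfun R (\sum_i strat_dim G i).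

Definition rv_eval i (p : ratvec i) x : strategy i := \row_k rf_eval (p k) x.

Definition feasible_extension u i (v : strategy i) (p : ratvec i) : Prop :=
  rv_eval p u = v /\
  forall x, KKT x ->
    (forall k, rf_dom (p k) x) /\ feasible x (rv_eval p x).

Definition positive_definite m (A : 'M[R]_m) : Prop :=
  A^T = A /\ forall w : 'rV[R]_m, w != 0 -> 0 < (w *m A *m w^T) ord0 ord0.

Variable Theta : 'M[R]_(1 + \sum_i strat_dim G i).

Definition quad x : R :=
  (row_mx 1%:M x *m Theta *m (row_mx 1%:M x)^T) ord0 ord0.

(* Configurations of Algorithm A.  The first argument of the three running
   ones is the loop counter, the second one the current set. *)
Inductive state :=
  | AtStep1 of nat & set profile
  | AtStep2 of nat & set profile & profile
  | AtStep3 of nat & set profile & profile & (forall i, strategy i)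
  | ReturnGNE of profile
  | ReportNone.

Definition init : state := AtStep1 0 KKT.

Definition gap u (v : forall i, strategy i) i : R :=
  objective u (v i) - objective u (block u i).

Definition cut_set u (v : forall i, strategy i)
    (p : forall i, ratvec i) : set profile :=
  [set x | forall i, gap u v i < 0 ->
     0 <= objective x (rv_eval (p i) x) - objective x (block x i)].

Inductive step : state -> state -> Prop :=
  | Step1_infeasible k U :
      U = set0 -> step (AtStep1 k U) ReportNone
  | Step1_minimizer k U u :
      is_minimizer U quad u -> step (AtStep1 k U) (AtStep2 k U u)
  | Step2_return k U u v :
      (forall i, is_minimizer (@feasible u i) (@objective u i) (v i)) ->
      (forall i, ~~ (gap u v i < 0)) ->
      step (AtStep2 k U u) (ReturnGNE u)
  | Step2_continue k U u v :
      (forall i, is_minimizer (@feasible u i) (@objective u i) (v i)) ->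
      (exists i, gap u v i < 0) ->
      step (AtStep2 k U u) (AtStep3 k U u v)
  | Step3_cut k U u v p :
      (forall i, gap u v i < 0 -> feasible_extension u (v i) (p i)) ->
      step (AtStep3 k U u v) (AtStep1 k.+1 (U `&` cut_set u v p)).

(* A complete run, under arbitrary choices of the minimizers and feasible
   extensions; it idles once no step is possible, either because it has
   produced an output or because a required object does not exist. *)
Definition run (s : nat -> state) : Prop :=
  s 0%N = init /\
  forall t, step (s t) (s t.+1) \/
            ((forall s', ~ step (s t) s') /\ s t.+1 = s t).

Definition minimizers_exist (s : nat -> state) : Prop :=
  (forall t k U, s t = AtStep1 k U -> U !=set0 ->
     exists u, is_minimizer U quad u) /\
  (forall t k U u, s t = AtStep2 k U u -> forall i, @feasible u i !=set0 ->
     exists v, is_minimizer (@feasible u i) (@objective u i) v).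

Definition extensions_exist (s : nat -> state) : Prop :=
  forall t k U u v, s t = AtStep3 k U u v ->
    forall i, gap u v i < 0 -> exists p, feasible_extension u (v i) p.

Lemma run_exists : exists s, run s.
Proof.
have /choice[f fP] : forall s, exists s', step s s' \/
    ((forall s'', ~ step s s'') /\ s' = s).
  move=> s; have [[s' ss']|nos] := pselect (exists s', step s s').
    by exists s'; left.
  by exists s; right; split=> // s' ss'; apply: nos; exists s'.
by exists (fun t => iter t f init); split=> // t; exact: fP.
Qed.

End Algorithm.
End Problem.

Arguments joint_feasible {R N} G _.
Arguments GNE {R N} G _.
Arguments ReportNone {R N G}.

(* Main.v *)
(** A point [u] discarded by Algorithm A lies in [KKT \ GNE], since some player
    gains by deviating to [v_i], and the cut built from [p_i] excludes [u]
    because [p_i(u) = v_i].  No cut removes an equilibrium [x] of [KKT], because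
    [p_i(x)] is feasible for player [i] and so cannot improve on [x_i].  Hence
    each loop strictly shrinks the finite set of non-equilibria of the current
    set while keeping all the equilibria of [KKT]. *)
Require Import Defs.
From mathcomp Require Import all_boot all_order all_algebra.
From mathcomp Require Import boolp classical_sets cardinality reals.
From mathcomp Require Import -(notations) mpoly.
Import Order.TTheory GRing.Theory Num.Theory.
Local Open Scope classical_set_scope.
Local Open Scope ring_scope.

Lemma subset_cut_set (R : realType) (N : nat) (G : rGNEP R N)
    (tau : forall i : 'I_N, mult_label G i -> ratfun R (\sum_i strat_dim G i))
    (u : profile G) (v : forall i, strategy G i) (p : forall i, ratvec G i) :
  (forall i, gap u v i < 0 -> feasible_extension tau u (v i) (p i)) ->
  KKT tau `&` GNE G `<=` cut_set u v p.
Proof.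
move=> ext x [Kx Ex] i /ext[_ /(_ x Kx)[_ px_feas]].
by rewrite subr_ge0; apply: (Ex i).2.
Qed.

(** Once [p_i(u)] is replaced by [v_i], the inequality that the cut imposes at [u] for player [i]
    reads [0 <= gap u v i]. *)
Lemma notin_cut_set (R : realType) (N : nat) (G : rGNEP R N)
    (u : profile G) (v : forall i, strategy G i) (p : forall i, ratvec G i)
    (i : 'I_N) :
  gap u v i < 0 -> rv_eval (p i) u = v i -> ~ cut_set u v p u.
Proof.
by move=> gap_lt0 pu_eq /(_ i gap_lt0); rewrite pu_eq leNgt => /negP; apply.
Qed.

Lemma gap_lt0_not_GNE (R : realType) (N : nat) (G : rGNEP R N)
    (u : profile G) (v : forall i, strategy G i) (i : 'I_N) :
  feasible u (v i) -> gap u v i < 0 -> ~ GNE G u.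
Proof.
move=> v_feas gap_lt0 /(_ i)[_ /(_ _ v_feas)].
by rewrite -subr_ge0 leNgt => /negP; apply.
Qed.

(** A nonnegative gap puts the value at [u_i] at or below the optimal value attained at [v_i], so
    [u_i] is optimal as well. *)
Lemma gap_ge0_GNE (R : realType) (N : nat) (G : rGNEP R N)
    (u : profile G) (v : forall i, strategy G i) :
  joint_feasible G u ->
  (forall i, is_minimizer (@feasible R N G u i) (@objective R N G u i) (v i)) ->
  (forall i, ~~ (gap u v i < 0)) -> GNE G u.
Proof.
move=> u_feas v_min gap_ge0 i; split=> [|y y_feas]; first exact: u_feas.
apply: le_trans ((v_min i).2 y y_feas).
by rewrite -subr_ge0 leNgt; apply: gap_ge0.
Qed.

(** A run idles only at states without a successor, so exhibiting one successor forces it to move.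
    It may move elsewhere; the inversion lemmas below recover the choices actually made. *)
Lemma run_step (R : realType) (N : nat) (G : rGNEP R N)
    (tau : forall i : 'I_N, mult_label G i -> ratfun R (\sum_i strat_dim G i))
    (Theta : 'M[R]_(1 + \sum_i strat_dim G i)) (s : nat -> state G) (t : nat) :
  run tau Theta s -> (exists s', step tau Theta (s t) s') ->
  step tau Theta (s t) (s t.+1).
Proof. by move=> [_ /(_ t)[//|[stuck _]]] [s' /stuck]. Qed.

Lemma AtStep3_step (R : realType) (N : nat) (G : rGNEP R N)
    (tau : forall i : 'I_N, mult_label G i -> ratfun R (\sum_i strat_dim G i))
    (Theta : 'M[R]_(1 + \sum_i strat_dim G i)) (k : nat) (U : set (profile G))
    (u : profile G) (v : forall i, strategy G i) :
  (forall i, gap u v i < 0 -> exists p, feasible_extension tau u (v i) p) ->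
  exists s', step tau Theta (AtStep3 k U u v) s'.
Proof.
move=> ext.
have p_exists i : exists p : ratvec G i,
    gap u v i < 0 -> feasible_extension tau u (v i) p.
  have [/ext[p pP]|_] := boolP (gap u v i < 0); first by exists p.
  (* [Step3_cut] takes a vector for every player; those outside the set of improving players get the
     constant [0/1] as a filler. *)
  by exists (fun=> RatFun 0 (oner_neq0 _)).
exists (AtStep1 k.+1
  (U `&` cut_set u v (fun i => sval (cid (p_exists i))))).
by apply: Step3_cut => i; apply: svalP (cid (p_exists i)).
Qed.

Lemma AtStep2_step (R : realType) (N : nat) (G : rGNEP R N)
    (tau : forall i : 'I_N, mult_label G i -> ratfun R (\sum_i strat_dim G i))
    (Theta : 'M[R]_(1 + \sum_i strat_dim G i)) (k : nat) (U : set (profile G))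
    (u : profile G) :
  (forall i, exists v,
     is_minimizer (@feasible R N G u i) (@objective R N G u i) v) ->
  exists s', step tau Theta (AtStep2 k U u) s'.
Proof.
move=> v_exists; pose v i := sval (cid (v_exists i)).
have v_min i : is_minimizer (@feasible R N G u i) (@objective R N G u i) (v i).
  exact: svalP (cid (v_exists i)).
have [some_lt0|none_lt0] := pselect (exists i, gap u v i < 0).
  by exists (AtStep3 k U u v); apply: Step2_continue.
exists (ReturnGNE u); apply: (Step2_return _ _ _ _ v_min) => i.
by apply/negP => gap_lt0; apply: none_lt0; exists i.
Qed.

Lemma step_AtStep1_inv (R : realType) (N : nat) (G : rGNEP R N)
    (tau : forall i : 'I_N, mult_label G i -> ratfun R (\sum_i strat_dim G i))
    (Theta : 'M[R]_(1 + \sum_i strat_dim G i)) (k : nat) (U : set (profile G))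
    (s' : state G) :
  step tau Theta (AtStep1 k U) s' ->
  U = set0 /\ s' = ReportNone \/
  exists2 u, is_minimizer U (quad Theta) u & s' = AtStep2 k U u.
Proof. by move=> st; inversion st; subst; [left|right; eexists; eauto]. Qed.

Lemma step_AtStep2_inv (R : realType) (N : nat) (G : rGNEP R N)
    (tau : forall i : 'I_N, mult_label G i -> ratfun R (\sum_i strat_dim G i))
    (Theta : 'M[R]_(1 + \sum_i strat_dim G i)) (k : nat) (U : set (profile G))
    (u : profile G) (s' : state G) :
  step tau Theta (AtStep2 k U u) s' ->
  exists2 v, forall i,
      is_minimizer (@feasible R N G u i) (@objective R N G u i) (v i) &
    (forall i, ~~ (gap u v i < 0)) /\ s' = ReturnGNE u \/
    (exists i, gap u v i < 0) /\ s' = AtStep3 k U u v.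
Proof. by move=> st; inversion st; subst; exists v; auto. Qed.

Lemma step_AtStep3_inv (R : realType) (N : nat) (G : rGNEP R N)
    (tau : forall i : 'I_N, mult_label G i -> ratfun R (\sum_i strat_dim G i))
    (Theta : 'M[R]_(1 + \sum_i strat_dim G i)) (k : nat) (U : set (profile G))
    (u : profile G) (v : forall i, strategy G i) (s' : state G) :
  step tau Theta (AtStep3 k U u v) s' ->
  exists2 p : forall i, ratvec G i,
    forall i, gap u v i < 0 -> feasible_extension tau u (v i) (p i) &
    s' = AtStep1 k.+1 (U `&` cut_set u v p).
Proof. by move=> st; inversion st; subst; exists p. Qed.

(** Induction on the length of a list [l] covering the non-equilibria of [U]. The loop invariants
    are that [U] stays inside [KKT] and keeps all its equilibria; time and counter are arbitrary so
    that the hypothesis applies after a loop. *)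
Lemma run_from_AtStep1 (R : realType) (N : nat) (G : rGNEP R N)
    (tau : forall i : 'I_N, mult_label G i -> ratfun R (\sum_i strat_dim G i))
    (Theta : 'M[R]_(1 + \sum_i strat_dim G i)) (s : nat -> state G)
    (l : seq (profile G)) (t k : nat) (U : set (profile G)) :
  run tau Theta s -> minimizers_exist Theta s -> extensions_exist tau s ->
  s t = AtStep1 k U -> U `<=` KKT tau -> KKT tau `&` GNE G `<=` U ->
  U `\` GNE G `<=` [set` l] ->
  exists t' : nat,
    (exists u : profile G, s t' = ReturnGNE u /\ GNE G u) \/
    (s t' = ReportNone /\ KKT tau `&` GNE G = set0).
Proof.
(* Only an upper bound on the length is tracked, since [l] may contain repetitions and a loop may
   then shorten it by more than one. *)
move=> s_run [min1 min2] s_ext; have [m] := ubnP (size l).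
elim: m l t k U => // m IHm l t k U size_l st UK EU Ul.
have step1 : step tau Theta (AtStep1 k U) (s t.+1).
  rewrite -st; apply: run_step => //; rewrite st.
  have [U0|/set0P U_neq0] := eqVneq U set0.
    by exists ReportNone; apply: Step1_infeasible.
  have [u u_min] := min1 t k U st U_neq0.
  by exists (AtStep2 k U u); apply: Step1_minimizer.
have [[U0 st1]|[u u_min st1]] := step_AtStep1_inv _ _ _ _ _ _ _ _ step1.
  (* Every equilibrium of [KKT] lies in [U], which is empty here. *)
  by exists t.+1; right; split=> //; rewrite -subset0 -U0.
have Uu := u_min.1; have [u_feas _ _ _] := UK _ Uu.
have step2 : step tau Theta (AtStep2 k U u) (s t.+2).
  rewrite -st1; apply: run_step => //; rewrite st1; apply: AtStep2_step => i.
  (* Each subproblem is feasible because [u] lies in [KKT]: its own block is a witness. *)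
  by apply: (min2 _ _ _ _ st1); exists (block u i).
have [v v_min [[gap_ge0 st2]|[[i gap_lt0] st2]]] :=
  step_AtStep2_inv _ _ _ _ _ _ _ _ _ step2.
  by exists t.+2; left; exists u; split=> //; apply: gap_ge0_GNE v_min gap_ge0.
have step3 : step tau Theta (AtStep3 k U u v) (s t.+3).
  rewrite -st2; apply: run_step => //; rewrite st2; apply: AtStep3_step.
  exact: s_ext st2.
have [p p_ext st3] := step_AtStep3_inv _ _ _ _ _ _ _ _ _ _ step3.
have u_cut := notin_cut_set _ _ _ _ _ p _ gap_lt0 (p_ext i gap_lt0).1.
have ul : u \in l.
  by apply: Ul; split=> //; apply: gap_lt0_not_GNE gap_lt0; apply: (v_min i).1.
(* All copies of [u] are deleted; as [u] occurs in [l], the list becomes strictly shorter. *)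
apply: (IHm [seq x <- l | x != u] _ _ _ _ st3).
- rewrite ltnS in size_l; apply: leq_trans size_l.
  rewrite size_filter -(count_predC (pred1 u)).
  by rewrite -[X in (X < _)%N]add0n ltn_add2r -has_count has_pred1.
- by move=> x [/UK].
- by move=> x KEx; split; [apply: EU|apply: subset_cut_set p_ext _ KEx].
- move=> x [[Ux x_cut] nEx] /=; rewrite mem_filter; apply/andP; split.
    (* A point surviving the cut differs from [u], which the cut excludes. *)
    by apply: contra_notN u_cut => /eqP xu; rewrite xu in x_cut.
  exact: Ul.
Qed.

Theorem theorem3p6 (R : realType) (N : nat) (G : rGNEP R N)
    (tau : forall i : 'I_N, mult_label G i -> ratfun R (\sum_i strat_dim G i))
    (Theta : 'M[R]_(1 + \sum_i strat_dim G i)) :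
  denominators_positive G ->
  multiplier_expressions tau ->
  positive_definite Theta ->
  forall s : nat -> state G,
    run tau Theta s ->
    minimizers_exist Theta s ->
    extensions_exist tau s ->
    finite_set (KKT tau `\` GNE G) ->
    exists t : nat,
      (exists u : profile G, s t = ReturnGNE u /\ GNE G u) \/
      [/\ s t = ReportNone,
          KKT tau `&` GNE G = set0
        & GNE G `<=` KKT tau -> GNE G = set0].
Proof.
move=> _ _ _ s s_run s_min s_ext /finite_seqP[l Kl].
have [t [t_ret|[t_none KE0]]] : exists t : nat,
    (exists u : profile G, s t = ReturnGNE u /\ GNE G u) \/
    (s t = ReportNone /\ KKT tau `&` GNE G = set0).
(* Initially [U] is [KKT] itself, and [l] enumerates its finitely many non-equilibria. *)
- apply: (run_from_AtStep1 _ _ _ tau Theta s l 0 0 (KKT tau)) => //.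
  + exact: s_run.1.
  + rewrite -Kl; exact: subset_refl.
- by exists t; left.
- exists t; right; split=> // EK.
  by rewrite -KE0 setIidr.
Qed.
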